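(* Let $C,D\subseteq\mathbb{R}^n$ be convex and $S\subseteq C\cap D$ non-empty. The elements of $\mathcal{F}(C-D;\{0\})$ are precisely the elements $U\in\mathcal{F}(C;S)\cap\mathcal{F}(D;S)$ for which there exists a finite sequence $V_0,\ldots,V_k\in\mathcal{F}(C;S)\cap\mathcal{F}(D;S)$ such that $V_0=\mathbb{R}^n$, $V_k=U$, and such that for each $i\in\{1,\ldots,k\}$ there is a $v_i\in\big(N_C^{V_{i-1}}(S)\cap(-N_D^{V_{i-1}}(S))\big)\setminus\{0\}$ with $V_i=V_{i-1}\cap v_i^\perp$.
   Context: $A\pm B=\{a\pm b\mid a\in A,b\in B\}$; $v^\perp$ is the orthogonal complement of $v$. For $C\subseteq\mathbb{R}^n$ convex and $S\subseteq C$ non-empty, $\mathcal{F}(C;S)$ is the set of all linear subspaces $U\subseteq\mathbb{R}^n$ (called supporting subspaces of $C$ at $S$) such that (1) $S-S\subseteq U$ and (2) $C\setminus(U+S)$ is convex. Nested normal cone: for a linear subspace $U\subseteq\mathbb{R}^n$ with $S-S\subseteq U$, $$N_C^U(S):=\{v\in U\mid \forall c\in C\cap(U+S),\ \forall s\in S,\ \langle c-s,v\rangle\le 0\}.$$ *)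

(* Defs.v *)
From HB Require Import structures.
From mathcomp Require Import all_boot all_order all_algebra.
From mathcomp Require Import boolp classical_sets reals convex.

Set Implicit Arguments.
Unset Strict Implicit.
Unset Printing Implicit Defensive.

Import Order.TTheory GRing.Theory Num.Theory.

Local Open Scope classical_set_scope.
Local Open Scope ring_scope.

Definition dotv (R : realType) (n : nat) (u v : 'rV[R]_n) : R :=
  \sum_(i < n) u 0 i * v 0 i.

(* The symmetric bilinear structure on [dotv] is what the library's orthogonal
   complement [orthov] takes as input. *)
Section DotvForm.
Variables (R : realType) (n : nat).

Let dotv_is_bilinear :
  bilinear_for *%R (idfun \; *%R) (@dotv R n : 'rV[R]_n -> 'rV[R]_n -> R).
Proof.
split=> w a u v; rewrite /= /dotv mulr_sumr -big_split; apply: eq_bigr => i _ /=.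
  by rewrite !mxE mulrDl mulrA.
by rewrite !mxE mulrDr mulrCA.
Qed.

HB.instance Definition _ := bilinear_isBilinear.Build R 'rV[R]_n 'rV[R]_n R
  *%R (idfun \; *%R) (@dotv R n) dotv_is_bilinear.

Let dotv_is_symmetric (u v : 'rV[R]_n) :
  dotv u v = (-1) ^+ false * idfun (dotv v u).
Proof.
by rewrite expr0 mul1r; apply: eq_bigr => i _; rewrite mulrC.
Qed.

HB.instance Definition _ :=
  isHermitianSesquilinear.Build R 'rV[R]_n false idfun (@dotv R n)
    dotv_is_symmetric.

End DotvForm.

Definition orthv (R : realType) (n : nat) (v : 'rV[R]_n) : {vspace 'rV[R]_n} :=
  orthov (@dotv R n) <[v]>.

Definition mink_add (V : zmodType) (A B : set V) : set V :=
  [set a + b | a in A & b in B].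

Definition mink_sub (V : zmodType) (A B : set V) : set V :=
  [set a - b | a in A & b in B].

Definition mink_opp (V : zmodType) (A : set V) : set V := [set - a | a in A].

Definition convex_in (R : realType) (n : nat) (C : set 'rV[R]_n) : Prop :=
  @convex_set R 'rV[R]_n C.

(* Meaningful for [C] convex and [S] a nonempty subset of [C]. *)
Definition supporting_subspaces (R : realType) (n : nat) (C S : set 'rV[R]_n) :
    set {vspace 'rV[R]_n} :=
  [set U | mink_sub S S `<=` [set` U] /\
           convex_in (C `\` mink_add [set` U] S)].

(* Meaningful when [S - S] is contained in [U]. *)
Definition nested_normal_cone (R : realType) (n : nat) (C : set 'rV[R]_n)
    (U : {vspace 'rV[R]_n}) (S : set 'rV[R]_n) : set 'rV[R]_n :=
  [set v | v \in U /\
           forall c s, (C `&` mink_add [set` U] S) c -> S s ->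
             dotv (c - s) v <= 0].

(* Main.v *)
Require Import Defs.
From HB Require Import structures.
From mathcomp Require Import all_boot all_order all_algebra.
From mathcomp Require Import interval_inference.
From mathcomp Require Import boolp classical_sets reals convex.

Set Implicit Arguments.
Unset Strict Implicit.
Unset Printing Implicit Defensive.

Import Order.TTheory GRing.Theory Num.Theory.

Local Open Scope classical_set_scope.
Local Open Scope ring_scope.

(** Write [E] for the convex set [C - D]. A subspace [U] leaves [E `\` [set` U]]
    convex exactly when [E :&: U] is a face of [E] in the sense that a positive
    combination of two points of [E] can lie in [U] only if both points do
    ([convex_setD_vspaceP]). Everything follows from this reformulation.

    Chains for [E] at the origin. If [E :&: W] is a face and [v] is a normal
    vector of it at 0, then cutting by [v^perp] gives again a face
    ([supporting_subspaces0_cap_orthv]), so the end of a chain of such cuts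
    starting at the full space is supporting. Conversely, let [U] be supporting
    and properly contained in [W]. Then the points of [E :&: W] outside [U] form
    a convex set, and in the nonzero space [W :&: U^perp] there is a nonzero
    vector [v] that is nonpositive on this set ([exists_normal]). As [v] vanishes
    on [U] it is a normal vector of [E :&: W] at 0. Cutting [W] by [v^perp] lowers
    the dimension, so iteration reaches [U] ([exists_normal_chain]). The convex
    set need be neither open nor closed, so [v] is obtained by a finite-dimensional
    Hahn-Banach argument: a normal vector of a hyperplane slice is extended one
    dimension at a time ([normal_extension], [separation]).

    Transfer to [C] and [D]. For [s] in [S], both [C - s] and [s - D] lie in [E],
    so a face of [E] restricts to faces of [C] and of [D]
    ([supporting_subspaces_mink_sub]). When [U] supports [E], the splitting
    [c - d = (c - s) + (s - d)] and the face property identify the normal cone of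
    [E] at 0 with the intersection of the cones of [C] and [-D]
    ([nested_normal_cone_mink_sub]). A chain for [E] is therefore a chain for [C]
    and [D]. Conversely, along a chain for [C] and [D] each member supports [E] by
    induction, the equality of cones at one member giving the next. *)

(** * Orthogonality in a subspace *)

Section Dot.
Context {R : realType} {n : nat}.
Implicit Types (x y u v : 'rV[R]_n) (U V W : {vspace 'rV[R]_n}).

Lemma dotvC u v : dotv u v = dotv v u.
Proof. by apply: eq_bigr => i _; rewrite mulrC. Qed.

Lemma dotvDl x y v : dotv (x + y) v = dotv x v + dotv y v.
Proof. exact: linearDl. Qed.

Lemma dotvZl a x v : dotv (a *: x) v = a * dotv x v.
Proof. exact: linearZl_LR. Qed.

Lemma dotvDr v x y : dotv v (x + y) = dotv v x + dotv v y.
Proof. exact: linearDr. Qed.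

Lemma dotvZr a v x : dotv v (a *: x) = a * dotv v x.
Proof. exact: linearZr_LR. Qed.

Lemma dotvNr v x : dotv v (- x) = - dotv v x.
Proof. exact: linearNr. Qed.

Lemma dotvv_eq0 u : dotv u u = 0 -> u = 0.
Proof.
move=> /eqP.
rewrite psumr_eq0 => [/allP u0|i _]; last by rewrite -expr2 sqr_ge0.
apply/rowP => i; apply/eqP; rewrite mxE -sqrf_eq0 expr2.
exact: u0 (mem_index_enum i).
Qed.

Lemma dotvNl x v : dotv (- x) v = - dotv x v.
Proof. exact: linearNl. Qed.

Lemma mem_orthv u v : (u \in orthv v) = (dotv u v == 0).
Proof. exact: mem_orthov1. Qed.

(** Each vector of [X] imposes one linear equation. *)
Lemma dim_cap_orthov_span (X : seq 'rV[R]_n) W :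
  (\dim W <= \dim (W :&: orthov (@dotv R n) <<X>>) + size X)%N.
Proof.
elim: X W => [|x X IH] W; first by rewrite span_nil orthov0 capvf addn0.
have le1 : (\dim W <= \dim (W :&: orthov (@dotv R n) <[x]>) + 1)%N.
  by rewrite addn1 (leq_trans (leqSpred _))// ltnS leq_dim_orthov1.
have le2 := IH (W :&: orthov (@dotv R n) <[x]>)%VS.
rewrite (leq_trans le1)//= -(addn1 (size X)) addnA leq_add2r.
apply: (leq_trans le2); rewrite leq_add2r; apply: dimvS.
rewrite -capvA capvS//; apply/subvP => v; rewrite memv_cap => /andP[vx vX].
rewrite mem_orthov_sym span_cons subv_add.
by apply/andP; split; rewrite -mem_orthov_sym.
Qed.

Lemma orthov_in_neq0 U W : (U <= W)%VS -> U != W ->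
  exists2 h, h \in (W :&: orthov (@dotv R n) U)%VS & h != 0.
Proof.
move=> UW neUW; set T := (W :&: _)%VS.
have T0 : T != 0%VS.
  have lt : (\dim U < \dim W)%N.
    by rewrite ltn_neqAle dimvS// andbT dimv_leqif_eq.
  have := dim_cap_orthov_span (vbasis U) W.
  rewrite (span_basis (vbasisP U)) -/T size_tuple -dimv_eq0 => le.
  apply/negP => /eqP T0; move: le.
  by rewrite T0 add0n leqNgt lt.
by exists (vpick T); [exact: memv_pick | rewrite vpick0].
Qed.

(** The double complement inside [W]: a point of [W] outside [U] would span
    with [U] a larger subspace, and a vector of it orthogonal to [U] would then
    be orthogonal to itself. *)
Lemma orthov_in_double U W x : (U <= W)%VS -> x \in W ->
  x \in orthov (@dotv R n) (W :&: orthov (@dotv R n) U)%VS -> x \in U.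
Proof.
move=> UW xW /mem_orthovP xT; apply/negPn/negP => xU.
have [||h] := @orthov_in_neq0 U (U + <[x]>)%VS.
- exact: addvSl.
- by apply: contra xU => /eqP ->; rewrite (subvP (addvSr _ _)) ?memv_line.
rewrite memv_cap => /andP[hUx hU] /eqP; apply; apply: dotvv_eq0.
have hW : h \in W by apply: subvP hUx; rewrite subv_add UW -memvE.
have xh : dotv x h = 0 by apply: xT; rewrite memv_cap hW.
case/memv_addP: hUx => u uU [_ /vlineP[a ->] hE].
rewrite {1}hE dotvDl dotvZl xh mulr0 addr0 dotvC.
exact: (mem_orthovP hU).
Qed.

End Dot.

(** * Convexity with unnormalised weights *)

Section Convexity.
Context {R : realType} {n : nat}.
Implicit Types (A E K : set 'rV[R]_n) (x y v h : 'rV[R]_n).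
Implicit Types (U W : {vspace 'rV[R]_n}).

(** Positive weights need not sum to 1: this keeps the unit interval type of
    the definition out of all later arguments. *)
Lemma convex_inP A : convex_in A <->
  forall (a b : R) x y, 0 < a -> 0 < b -> A x -> A y ->
    A ((a + b)^-1 *: (a *: x + b *: y)).
Proof.
split=> [cA a b x y a0 b0 Ax Ay|cA].
  have ab0 : 0 < a + b by rewrite addr_gt0.
  have t0 : 0 <= (a + b)^-1 * a by rewrite mulr_ge0 ?invr_ge0 ?ltW.
  have t1 : (a + b)^-1 * a <= 1.
    by rewrite mulrC ler_pdivrMr// mul1r lerDl ltW.
  have := cA x y (Itv01 t0 t1) (mem_set Ax) (mem_set Ay).
  rewrite inE /conv /= => Axy; rewrite scalerDr !scalerA.
  suff -> : (a + b)^-1 * b = 1 - (a + b)^-1 * a by [].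
  apply/eqP; rewrite eq_sym subr_eq -mulrDr [b + a]addrC mulVf//.
  by rewrite gt_eqF.
apply/convex_setW => x y /set_mem Ax /set_mem Ay k k0 k1; apply: mem_set.
have l0 : 0 < 1 - k%:num by rewrite subr_gt0.
have := cA _ _ _ _ k0 l0 Ax Ay.
by rewrite addrC subrK invr1 scale1r.
Qed.

(** The second supporting condition as a face property. If just one of [x], [y]
    lay in [U], a positive combination would not, so only the case where both
    lie outside [U] says something about [E `\` [set` U]]. *)
Lemma convex_setD_vspaceP E U : convex_in E ->
  convex_in (E `\` [set` U]) <->
  forall (a b : R) x y, 0 < a -> 0 < b -> E x -> E y ->
    a *: x + b *: y \in U -> x \in U /\ y \in U.
Proof.
move=> /convex_inP cE; split=> [/convex_inP cEU a b x y a0 b0 Ex Ey xyU|face].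
  have [xU|/negP xU] := pselect (x \in U).
    split=> //; move: xyU.
    by rewrite addrC (rpredDr _ (rpredZ a xU)) rpredZeq gt_eqF.
  have [yU|/negP yU] := pselect (y \in U).
    by split=> //; move: xyU; rewrite (rpredDr _ (rpredZ b yU)) rpredZeq gt_eqF.
  have [] := cEU a b x y a0 b0; [by split=> //; apply/negP..|].
  by move=> _ []; rewrite /= rpredZ.
apply/convex_inP => a b x y a0 b0 [Ex /= xU] [Ey yU]; split.
  exact: cE.
move=> /= zU; apply: xU; apply: (face a b x y a0 b0 Ex Ey _).1.
have ab0 : a + b != 0 by rewrite gt_eqF// addr_gt0.
by rewrite -[_ + _](scalerKV ab0) rpredZ.
Qed.

(** * Separation of a convex set from a subspace *)

(** The one-dimensional Hahn-Banach step. Each point of [K] with a negative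
    (positive) [h]-component bounds [s] from below (above); a lower bound
    exceeding an upper one would combine the two points into a point of
    [K :&: h^perp] where [v] is positive. *)
Lemma normal_extension K v h : convex_in K ->
  (forall x, K x -> dotv x h = 0 -> dotv x v <= 0) ->
  (exists2 p, K p & 0 < dotv p h) -> (exists2 q, K q & dotv q h < 0) ->
  exists s, forall x, K x -> dotv x (v + s *: h) <= 0.
Proof.
move=> /convex_inP cK vK [p Kp p0] [q Kq q0].
pose B : set R :=
  [set dotv x v / - dotv x h | x in [set x | K x /\ dotv x h < 0]].
have ubB x : K x -> 0 < dotv x h -> ubound B (- dotv x v / dotv x h).
  move=> Kx x0 _ [y [Ky y0] <-].
  have y0' : 0 < - dotv y h by rewrite oppr_gt0.
  have := vK _ (cK _ _ _ _ y0' x0 Kx Ky).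
  have i0 : 0 < (- dotv y h + dotv x h)^-1 by rewrite invr_gt0 addr_gt0.
  have e : - dotv y h * dotv x h + dotv x h * dotv y h = 0.
    by rewrite mulNr mulrC addNr.
  rewrite !dotvZl !dotvDl !dotvZl e mulr0 => /(_ erefl); rewrite pmulr_rle0//.
  rewrite mulNr addrC subr_le0 => le.
  rewrite ler_pdivrMr// mulrAC ler_pdivlMr// mulrNN.
  by rewrite mulrC [leRHS]mulrC.
have Bq : B !=set0 by exists (dotv q v / - dotv q h), q.
have hB : has_ubound B by exists (- dotv p v / dotv p h); exact: ubB.
exists (sup B) => x Kx; rewrite dotvDr dotvZr.
have [x0|x0|x0] := ltgtP (dotv x h) 0.
- have : dotv x v / - dotv x h <= sup B by apply: ub_le_sup => //; exists x.
  by rewrite ler_pdivrMr ?oppr_gt0// mulrN -subr_ge0 -opprD oppr_ge0 addrC.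
- have := ge_sup Bq (ubB _ Kx x0).
  by rewrite ler_pdivlMr// -subr_le0 opprK addrC.
- by rewrite x0 mulr0 addr0 vK.
Qed.

(** Weak separation, for a convex set that need be neither open nor closed, by
    induction on the directions [X] available for the normal vector: a normal
    vector for the slice of [K] orthogonal to the first direction extends to
    all of [K], unless [K] lies on one side of that direction already. *)
Lemma separation (X : seq 'rV[R]_n) K : free X -> X != [::] -> convex_in K ->
  (forall x, K x -> x \notin orthov (@dotv R n) <<X>>%VS) ->
  exists v, [/\ v \in <<X>>%VS, v != 0 & forall x, K x -> dotv x v <= 0].
Proof.
elim: X K => [//|h X IH] K freeX _ cK nzK.
have h0 : h != 0 by apply: free_not0 (mem_head h X); exact: freeX.
have hX : h \in <<h :: X>>%VS by rewrite memv_span ?mem_head.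
move: freeX; rewrite free_cons => /andP[hNX freeX].
have [[q Kq q0]|noq] := pselect (exists2 q, K q & dotv q h < 0); last first.
  exists (- h); split; rewrite ?rpredN ?oppr_eq0// => x Kx.
  by rewrite dotvNr oppr_le0 leNgt; apply/negP => x0; apply: noq; exists x.
have [[p Kp p0]|nop] := pselect (exists2 p, K p & 0 < dotv p h); last first.
  exists h; split=> // x Kx.
  by rewrite leNgt; apply/negP => x0; apply: nop; exists x.
pose K' : set 'rV[R]_n := [set x | K x /\ dotv x h = 0].
have [K'c K'X] : convex_in K' /\
    forall x, K' x -> x \notin orthov (@dotv R n) <<X>>%VS.
  split.
    move/convex_inP in cK; apply/convex_inP => a b x y a0 b0 [Kx x0] [Ky y0].
    by split; [exact: cK | rewrite dotvZl dotvDl !dotvZl x0 y0 !(mulr0, addr0)].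
  move=> x [Kx x0]; apply: contra (nzK x Kx) => xX.
  rewrite mem_orthov_sym span_cons subv_add.
  apply/andP; split; rewrite -mem_orthov_sym//.
  by rewrite mem_orthov1; apply/eqP.
have Xn0 : X != [::].
  (* the segment from [p] to [q] meets [K'], none of whose points is orthogonal
     to [X] *)
  have := K'X ((- dotv q h + dotv p h)^-1 *:
               (- dotv q h *: p + dotv p h *: q)).
  case: (X) => [|//] K'0; exfalso; move: K'0; rewrite span_nil orthov0 memvf.
  move=> /(_ _)/negP; apply=> //; split.
    by move/convex_inP: cK; apply; rewrite ?oppr_gt0.
  by rewrite dotvZl dotvDl !dotvZl mulNr [dotv p h * _]mulrC addNr mulr0.
have [v [vX v0 vK]] := IH K' freeX Xn0 K'c K'X.
have [|||s sK] := @normal_extension K v h cK.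
- by move=> x Kx x0; apply: vK.
- by exists p.
- by exists q.
exists (v + s *: h); split=> //.
  rewrite rpredD ?rpredZ//; apply: subvP vX; rewrite span_cons; exact: addvSr.
(* [h] is not in the span of [X], so [s] would be 0 and hence [v] as well *)
apply: contra v0; rewrite addr_eq0 => /eqP vE.
have [s0|s0] := eqVneq s 0; first by rewrite vE s0 scale0r oppr0.
case/negP: hNX; have : s *: h \in <<X>>%VS by rewrite -[s *: h]opprK -vE rpredN.
by rewrite rpredZeq (negPf s0).
Qed.

End Convexity.

(** * Supporting subspaces at the origin *)

Section AtOrigin.
Context {R : realType} {n : nat}.
Implicit Types (E : set 'rV[R]_n) (U W : {vspace 'rV[R]_n}).

Lemma mink_add0 (A : set 'rV[R]_n) : mink_add A [set 0] = A.
Proof.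
rewrite eqEsubset; split=> [_ [a Aa [_ -> <-]]|a Aa]; first by rewrite addr0.
by exists a => //; exists 0; rewrite ?addr0.
Qed.

Lemma supporting_subspaces0P E U :
  supporting_subspaces E [set 0] U <-> convex_in (E `\` [set` U]).
Proof.
rewrite /supporting_subspaces /= mink_add0; split=> [[]//|cEU]; split=> //.
by move=> _ [_ -> [_ -> <-]] /=; rewrite subr0 rpred0.
Qed.

Lemma nested_normal_cone0P E W v : nested_normal_cone E W [set 0] v <->
  v \in W /\ forall e, E e -> e \in W -> dotv e v <= 0.
Proof.
rewrite /nested_normal_cone /= mink_add0.
split=> -[vW vE]; split=> // e; first by move=> Ee eW; rewrite -[e]subr0 vE.
by move=> _ [Ee eW] ->; rewrite subr0 vE.
Qed.

(** If a positive combination of points of the face [E :&: W] lies in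
    [v^perp], the two values of [v], both nonpositive, must vanish. *)
Lemma supporting_subspaces0_cap_orthv E W v : convex_in E ->
  supporting_subspaces E [set 0] W -> nested_normal_cone E W [set 0] v ->
  supporting_subspaces E [set 0] (W :&: orthv v)%VS.
Proof.
move=> cE /supporting_subspaces0P/(convex_setD_vspaceP _ cE) fW.
move=> /nested_normal_cone0P[_ vE].
apply/supporting_subspaces0P/(convex_setD_vspaceP _ cE) => a b x y a0 b0 Ex Ey.
rewrite memv_cap mem_orthv dotvDl !dotvZl => /andP[xyW].
have [xW yW] := fW a b x y a0 b0 Ex Ey xyW.
have xv : a * dotv x v <= 0 by rewrite pmulr_rle0// vE.
have yv : b * dotv y v <= 0 by rewrite pmulr_rle0// vE.
rewrite naddr_eq0// !mulf_eq0 (gt_eqF a0) (gt_eqF b0) => /andP[/= xv0 yv0].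
by rewrite !memv_cap xW yW !mem_orthv.
Qed.

(** The admissible directions for a normal vector of [E :&: W] vanishing on [U]
    are those of [T = W :&: U^perp]. By the double complement, a point of
    [E :&: W] is orthogonal to [T] only if it lies in [U], so removing [U] leaves
    exactly the set to which the separation lemma applies. *)
Lemma exists_normal E U W : convex_in (E `\` [set` U]) -> (U <= W)%VS ->
  U != W ->
  exists v, (nested_normal_cone E W [set 0] `\ 0) v /\ (U <= orthv v)%VS.
Proof.
move=> cEU UW neUW; pose T := (W :&: orthov (@dotv R n) U)%VS.
have [h hT h0] := orthov_in_neq0 UW neUW.
have spanT : <<vbasis T>>%VS = T := span_basis (vbasisP T).
pose K : set 'rV[R]_n := [set x | (E `\` [set` U]) x /\ x \in W].
have [|||v [vT v0 vK]] := @separation R n (vbasis T) K (basis_free (vbasisP T)).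
- apply: contraNneq h0 => X0; move: hT.
  by rewrite -/T -spanT X0 span_nil memv0.
- move/convex_inP: cEU => cEU.
  apply/convex_inP => a b x y a0 b0 [Ex xW] [Ey yW].
  by split; [exact: cEU | rewrite rpredZ// rpredD// rpredZ].
- move=> x [[Ex /= xU] xW]; rewrite spanT; apply/negP => xT.
  by apply: xU; exact: orthov_in_double xT.
move: vT; rewrite spanT memv_cap => /andP[vW vU].
have Uv : (U <= orthv v)%VS by rewrite /orthv -mem_orthov_sym.
exists v; split=> //; split; last exact/eqP.
apply/nested_normal_cone0P; split=> // e Ee eW.
have [eU|eU] := boolP (e \in U); last first.
  by apply: vK; split=> //; split=> //; apply/negP.
by have /subvP/(_ e eU) := Uv; rewrite mem_orthv => /eqP ->.
Qed.

(** Stated from an arbitrary [W] above [U], not only from the full space,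
    because the induction on the dimension restarts from the first cut of [W]. *)
Lemma exists_normal_chain E U W : convex_in E ->
  supporting_subspaces E [set 0] U -> supporting_subspaces E [set 0] W ->
  (U <= W)%VS ->
  exists (k : nat) (V : nat -> {vspace 'rV[R]_n}),
    [/\ forall i, (i <= k)%N -> supporting_subspaces E [set 0] (V i),
        V 0%N = W, V k = U &
        forall i, (1 <= i <= k)%N ->
          exists2 v, (nested_normal_cone E (V i.-1) [set 0] `\ 0) v &
                     V i = (V i.-1 :&: orthv v)%VS].
Proof.
move=> cE /[dup] sU /supporting_subspaces0P cEU.
have [m] := ubnP (\dim W); elim: m W => // m IH W; rewrite ltnS => dimW sW UW.
have [->|neUW] := eqVneq U W.
  by exists 0%N, (fun=> W); split=> // -[].
have [v [[vW v0] Uv]] := exists_normal cEU UW neUW.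
have vWin : v \in W by case: vW.
have lt : (\dim (W :&: orthv v) < \dim W)%N.
  rewrite ltn_neqAle dimvS ?capvSl// andbT (dimv_leqif_eq (capvSl _ _)).
  apply/negP => /eqP Wv; apply: v0; apply: dotvv_eq0; apply/eqP.
  by rewrite -mem_orthv; move: vWin; rewrite -{1}Wv memv_cap => /andP[].
have [|||k [V [sV V0 Vk Vi]]] := IH (W :&: orthv v)%VS.
- exact: leq_trans dimW.
- exact: supporting_subspaces0_cap_orthv.
- by rewrite subv_cap UW.
exists k.+1, (fun i => if i is j.+1 then V j else W); split=> //.
- by case=> // i; apply: sV.
- by case=> // -[_|i ik]; [exists v; rewrite ?V0 | apply: (Vi i.+1)].
Qed.

End AtOrigin.

(** * Transfer to the difference of two convex sets *)

Section Difference.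
Context {R : realType} {n : nat}.
Variables C D S : set 'rV[R]_n.
Hypotheses (convC : convex_in C) (convD : convex_in D).
Hypotheses (subS : S `<=` C `&` D) (S_neq0 : S !=set0).
Implicit Types (U : {vspace 'rV[R]_n}).

Let CmS x s : C x -> S s -> mink_sub C D (x - s).
Proof. by move=> Cx /subS[_ Ds]; exists x => //; exists s. Qed.

Let SmD x s : D x -> S s -> mink_sub C D (s - x).
Proof. by move=> Dx /subS[Cs _]; exists s => //; exists x. Qed.

Lemma convex_mink_sub : convex_in (mink_sub C D).
Proof.
move/convex_inP: convC => cC; move/convex_inP: convD => cD.
apply/convex_inP => a b _ _ a0 b0 [c Cc [d Dd <-]] [c' Cc' [d' Dd' <-]].
exists ((a + b)^-1 *: (a *: c + b *: c')); first exact: cC.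
exists ((a + b)^-1 *: (a *: d + b *: d')); first exact: cD.
by rewrite -scalerBr opprD addrACA -!scalerBr.
Qed.

(** A face of [C - D] restricts to a face of [X], where [X] is [C] or [D]; the
    sign [g] accounts for [D] entering the difference negatively. *)
Let supporting_transfer X (g : R) U : convex_in X -> g != 0 ->
  (forall x s, X x -> S s -> mink_sub C D (g *: (x - s))) -> S `<=` X ->
  supporting_subspaces (mink_sub C D) [set 0] U -> supporting_subspaces X S U.
Proof.
move=> /convex_inP cX g0 XS SX.
move=> /supporting_subspaces0P/(convex_setD_vspaceP _ convex_mink_sub) fU.
have inU x : g *: x \in U -> x \in U by rewrite rpredZeq (negPf g0).
have SU : mink_sub S S `<=` [set` U].
  move=> _ [s Ss [t St <-]] /=; apply: inU.
  have Es := XS _ _ (SX _ Ss) St; have Et := XS _ _ (SX _ St) Ss.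
  apply: (fU 1 1 _ _ ltr01 ltr01 Es Et _).1.
  by rewrite !scale1r -scalerDr addrA subrK subrr scaler0 rpred0.
split=> //; apply/convex_inP => a b x y a0 b0 [Xx xU] [Xy yU].
split; first exact: cX.
move=> [u uU [s Ss zE]]; apply: xU; exists (x - s); last first.
  by exists s; rewrite ?subrK.
apply: inU; apply: (fU a b _ _ a0 b0 (XS _ _ Xx Ss) (XS _ _ Xy Ss) _).1.
have ab0 : a + b != 0 by rewrite gt_eqF ?addr_gt0.
rewrite !scalerA ![_ * g]mulrC -!scalerA -scalerDr rpredZ// !scalerBr addrACA.
rewrite -opprD -scalerDl -[a *: x + _](scalerKV ab0) -zE.
by rewrite -scalerBr addrK rpredZ.
Qed.

Lemma supporting_subspaces_mink_sub :
  supporting_subspaces (mink_sub C D) [set 0] `<=`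
  supporting_subspaces C S `&` supporting_subspaces D S.
Proof.
move=> U sU; split.
- have N1 := oner_neq0 R.
  apply: (supporting_transfer convC N1 _ _ sU) => [x s Cx Ss|s /subS[]//].
  by rewrite scale1r; apply: CmS.
- have N10 : (-1 : R) != 0 by rewrite oppr_eq0 oner_neq0.
  apply: (supporting_transfer convD N10 _ _ sU) => [x s Dx Ss|s /subS[]//].
  by rewrite scaleN1r opprB; apply: SmD.
Qed.

(** Where [U] supports [C - D], a difference [c - d] in [U] splits as
    [(c - s) + (s - d)] with both terms in [U], because [U] cuts out a face. So
    a linear form is nonpositive on the face of [C - D] exactly when it is on
    the corresponding parts of [C - s] and [s - D]. *)
Lemma nested_normal_cone_mink_sub U :
  supporting_subspaces (mink_sub C D) [set 0] U ->
  nested_normal_cone (mink_sub C D) U [set 0] =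
  nested_normal_cone C U S `&` mink_opp (nested_normal_cone D U S).
Proof.
move=> sU; have [[SU _] _] := supporting_subspaces_mink_sub sU.
move/supporting_subspaces0P/(convex_setD_vspaceP _ convex_mink_sub) : sU => fU.
have inU s t u : S s -> S t -> u \in U -> u + t - s \in U.
  move=> Ss St uU; rewrite -addrA rpredD//.
  by apply: SU; exists t => //; exists s.
rewrite eqEsubset; split=> v.
  move=> /nested_normal_cone0P[vU vE]; split.
    split=> // c s [Cc [u uU [t St cE]]] Ss.
    by apply: vE; [exact: CmS | rewrite -cE inU].
  exists (- v); last by rewrite opprK.
  split=> [|d s [Dd [u uU [t St dE]]] Ss]; first by rewrite rpredN.
  rewrite dotvNr -dotvNl opprB; apply: vE; first exact: SmD.
  by rewrite -opprB rpredN -dE inU.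
move=> [[vU vC] [w [_ wD] wv]]; apply/nested_normal_cone0P; split=> //.
move=> _ [c Cc [d Dd <-]] cdU; have [s Ss] := S_neq0.
have [csU sdU] : c - s \in U /\ s - d \in U.
  apply: (fU 1 1 _ _ ltr01 ltr01 (CmS Cc Ss) (SmD Dd Ss)).
  by rewrite !scale1r addrA subrK.
rewrite -[c - d](subrKA s) dotvDl -[leRHS](addr0 0); apply: lerD.
  by apply: vC => //; split=> //; exists (c - s) => //; exists s; rewrite ?subrK.
rewrite -wv dotvNr -dotvNl opprB; apply: wD => //; split=> //.
by exists (d - s); [rewrite /= -opprB rpredN | exists s; rewrite ?subrK].
Qed.

End Difference.

(** * The supporting subspaces of a difference *)

Theorem corollary6p2 (R : realType) (n : nat) (C D S : set 'rV[R]_n)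
    (convC : convex_in C) (convD : convex_in D)
    (subS : S `<=` C `&` D) (S_neq0 : S !=set0) :
  supporting_subspaces (mink_sub C D) [set 0] =
  [set U | (supporting_subspaces C S `&` supporting_subspaces D S) U /\
    exists (k : nat) (V : nat -> {vspace 'rV[R]_n}),
      [/\ forall i, (i <= k)%N ->
            (supporting_subspaces C S `&` supporting_subspaces D S) (V i),
          V 0%N = fullv,
          V k = U &
          forall i, (1 <= i <= k)%N ->
            exists2 v : 'rV[R]_n,
              ((nested_normal_cone C (V i.-1) S `&`
                mink_opp (nested_normal_cone D (V i.-1) S)) `\ 0) v &
              V i = (V i.-1 :&: orthv v)%VS]].
Proof.
have cE := convex_mink_sub convC convD.
have sFull : supporting_subspaces (mink_sub C D) [set 0] fullv.
  by apply/supporting_subspaces0P/(convex_setD_vspaceP _ cE) => *; rewrite !memvf.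
have toCD := supporting_subspaces_mink_sub convC convD subS.
have coneE := nested_normal_cone_mink_sub convC convD subS S_neq0.
rewrite eqEsubset; split=> [U sU|U [_ [k [V [_ V0 <- Vi]]]]].
  split; first exact: toCD.
  have [k [V [sV V0 Vk Vi]]] := exists_normal_chain cE sU sFull (subvf U).
  exists k, V; split=> // i ik; first by apply: toCD; apply: sV.
  have [v vN vE] := Vi i ik; exists v => //; rewrite -coneE//.
  by apply: sV; case: i ik {vN vE} => //= i; exact: ltnW.
elim: k => [|k IH] in Vi *; first by rewrite V0.
have sVk : supporting_subspaces (mink_sub C D) [set 0] (V k).
  by apply: IH => i /andP[i1 ik]; apply: Vi; rewrite i1 leqW.
have [|v [vN _] ->] := Vi k.+1; first by rewrite leqnn.
by apply: supporting_subspaces0_cap_orthv => //; rewrite coneE.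
Qed.
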